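(* Let $\mathcal{A}$ be a finitely generated commutative unital $\mathbb{R}$-algebra and $\mathcal{S}$ an Archimedean semiring of $\mathcal{A}$. Suppose that $J$ is an unbounded closed subset of $\mathbb{R}$. Let $a=\sum_{i=0}^{2k}a_iz^i\in\mathcal{A}[z]$ with coefficients $a_0,\dots,a_{2k}\in\mathcal{A}$, $k\in\mathbb{N}_0$. Then the following are equivalent: (i) $\varphi(a(\eta))>0$ for all $(\varphi,\eta)\in\mathrm{char}(\mathcal{A},\mathcal{S})\times J$, and $\psi(a_{2k})>0$ for all $\psi\in\mathrm{char}(\mathcal{A},\mathcal{S})$. (ii) There exists $\epsilon\in(0,\infty)$ such that $a\in\epsilon(1+z^2)^k+\mathcal{S}\otimes\mathrm{Pos}(J)$.
   Context: Let $\mathcal{A}$ be a commutative unital $\mathbb{R}$-algebra with unit $1$. A semiring of $\mathcal{A}$ is a subset $\mathcal{S}$ containing $1$ that is closed under addition, under multiplication by real scalars $\lambda\ge0$, and under multiplication. It is Archimedean if for every $a\in\mathcal{A}$ there is $\lambda\in(0,\infty)$ with $\lambda1-a\in\mathcal{S}$ and $\lambda1+a\in\mathcal{S}$. $\mathrm{char}(\mathcal{A},\mathcal{S})$ is the set of unital algebra homomorphisms $\varphi:\mathcal{A}\to\mathbb{R}$ with $\varphi(b)\ge0$ for all $b\in\mathcal{S}$. $\mathcal{A}[z]\cong\mathcal{A}\otimes\mathbb{R}[z]$ is the algebra of polynomials in one variable $z$ with coefficients in $\mathcal{A}$; for $a=\sum_ia_iz^i$ and $\eta\in\mathbb{R}$,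 $a(\eta)=\sum_i\eta^ia_i\in\mathcal{A}$. For $J\subseteq\mathbb{R}$, $\mathrm{Pos}(J):=\{p\in\mathbb{R}[z] : p(t)\ge0 \text{ for all } t\in J\}$, and $\mathcal{S}\otimes\mathrm{Pos}(J)\subseteq\mathcal{A}[z]$ is the convex cone of finite sums of elements $bp$ with $b\in\mathcal{S}$ and $p\in\mathrm{Pos}(J)$. *)

(* Defs.v *)
From HB Require Import structures.
From mathcomp Require Import all_boot all_order all_algebra.
From mathcomp Require Import all_classical all_reals all_analysis.
Set Implicit Arguments.
Unset Strict Implicit.
Unset Printing Implicit Defensive.
Import Order.TTheory GRing.Theory Num.Theory.
Import numFieldNormedType.Exports.
Local Open Scope classical_set_scope.
Local Open Scope ring_scope.

(* No proper subalgebra contains the generators [gens]. *)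
Definition finitely_generated (R : realType) (A : comAlgType R) : Prop :=
  exists gens : seq A, forall B : {pred A},
    GRing.subalg_closed B -> {subset gens <= B} -> forall x : A, x \in B.

Definition is_semiring (R : realType) (A : comAlgType R) (S : set A) : Prop :=
  [/\ S 1,
      forall b c : A, S b -> S c -> S (b + c),
      forall (lambda : R) (b : A), 0 <= lambda -> S b -> S (lambda *: b)
    & forall b c : A, S b -> S c -> S (b * c)].

Definition is_archimedean (R : realType) (A : comAlgType R) (S : set A) : Prop :=
  forall a : A, exists lambda : R,
    [/\ 0 < lambda, S (lambda%:A - a) & S (lambda%:A + a)].

(* [{lrmorphism A -> R | *%R}] is the type of unital R-algebra homomorphisms
   from A to R. *)
Definition char (R : realType) (A : comAlgType R) (S : set A) :
    set {lrmorphism A -> R | *%R} :=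
  [set phi | forall b : A, S b -> 0 <= phi b].

(* In a(eta), the real number eta is identified with the element eta%:A. *)
Definition evalr (R : realType) (A : comAlgType R) (a : {poly A}) (eta : R) : A :=
  a.[eta%:A].

Definition Pos (R : realType) (J : set R) : set {poly R} :=
  [set p | forall t : R, J t -> 0 <= p.[t]].

(* The product b p in A[z] is [b *: map_poly (in_alg A) p], where
   [map_poly (in_alg A)] is the canonical map from R[z] to A[z]. *)
Definition tensor_Pos (R : realType) (A : comAlgType R) (S : set A)
    (J : set R) : set {poly A} :=
  [set q | exists (n : nat) (b : 'I_n -> A) (p : 'I_n -> {poly R}),
     [/\ forall i, S (b i), forall i, Pos J (p i)
       & q = \sum_(i < n) b i *: map_poly (in_alg A) (p i)]].

(* Main.v *)
From HB Require Import structures.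
Require Import Defs.
From mathcomp Require Import all_boot all_order all_algebra.
From mathcomp Require Import all_classical all_reals all_analysis.
From mathcomp Require Import ring lra.
Set Implicit Arguments.
Unset Strict Implicit.
Unset Printing Implicit Defensive.
Import Order.TTheory GRing.Theory Num.Theory.
Import numFieldNormedType.Exports.
Local Open Scope classical_set_scope.
Local Open Scope ring_scope.

(** Write E for the polynomial (1 + z^2)^k.  The polynomials of degree at most
    2k form an A-module W, and those of them that lie in the cone generated by
    products b p, with b in S and p in Pos(J), form a convex cone P, stable
    under multiplication by S, with order unit E ([tensor_Pos_order_unit]).
    The order unit is what the degree bound buys: E + z^i and E - z^i are
    nonnegative on the line for i <= 2k, and S is Archimedean.

    The implication from (i) to (ii) is an instance of a Positivstellensatz for
    modules over an Archimedean semiring ([archimedean_representation]): if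
    L a > 0 for every additive functional L on W which is nonnegative on P, has
    L E = 1, and is multiplicative over some character phi in the sense that
    L (b x) = phi b * L x, then a - eps E belongs to P for some eps > 0.
    To verify its hypothesis, note that such an L only sees the real polynomial
    phi(a) obtained by applying phi to the coefficients
    ([eq_state_of_map_poly]).  By (i), phi(a) is positive on J and has positive
    coefficient of degree 2k, so it is at least c E on J for some c > 0: near
    infinity because of the top coefficient, elsewhere by compactness
    ([Pos_sub_eps]).  Hence phi(a) - c E is in Pos(J), and L a >= c > 0.

    The module Positivstellensatz is proved by contradiction with Zorn's lemma.
    If - E is in the S-cone generated by P and - a, then s a - E is in P for
    some s in S, and a descent using N 1 - s in S turns this into the
    conclusion ([archimedean_descent]).  Otherwise that S-cone lies in a maximal
    one omitting - E.  A maximal S-cone M is total: every x or its opposite is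
    in M ([maximal_S_cone_total]).  A total preorder with an order unit
    has a unique state L, and because M is stable under S, this state is
    multiplicative over the character b |-> L (b E) ([total_S_cone_state]).
    Since - a is in M, it satisfies L a <= 0, against the hypothesis.

    The implication from (ii) to (i) is obtained by applying characters: a real
    polynomial of degree at most 2k that is nonnegative on the unbounded set J
    has a nonnegative coefficient of degree 2k ([Pos_coef_ge0]). *)

(** * Real polynomials nonnegative on an unbounded closed set *)

Section RealPolynomials.
Context (R : realType).
Implicit Types (p : {poly R}) (J : set R).

(** For |t| >= 1 the lower terms are at most B |t|^(2k-1), where B is the sum
    of the absolute values of their coefficients, so the top term wins as soon
    as |t| exceeds B divided by the top coefficient. *)
Lemma horner_even_degree_ge0 p (k : nat) :
    (size p <= (2 * k).+1)%N -> 0 < p`_(2 * k) ->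
  exists T : R, forall t, T <= `|t| -> 0 <= p.[t].
Proof.
move=> sp p_gt0; pose B := \sum_(i < 2 * k) `|p`_i|.
exists (1 + B / p`_(2 * k)) => t tT.
have B0 : 0 <= B by exact: sumr_ge0.
have Bp0 : 0 <= B / p`_(2 * k) by rewrite divr_ge0 // ltW.
have t1 : 1 <= `|t| by lra.
have tB : B <= `|t| * p`_(2 * k) by rewrite -ler_pdivrMr //; lra.
have tk : 0 <= t ^+ (2 * k) by rewrite exprM exprn_ge0 // sqr_ge0.
rewrite (horner_coef_wide _ sp) big_ord_recr /=.
have t0 : 0 < `|t| by lra.
set low := \sum_(i < _) _.
have low_le : `|t| * `|low| <= B * t ^+ (2 * k).
  apply: (@le_trans _ _ (`|t| * \sum_(i < 2 * k) `|p`_i * t ^+ i|)).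
    by rewrite ler_pM2l // ler_norm_sum.
  rewrite mulr_sumr mulr_suml; apply: ler_sum => i _.
  rewrite normrM mulrCA ler_wpM2l // normrX -exprS.
  by rewrite -[leRHS]ger0_norm // normrX ler_weXn2l.
(* Multiplying by |t| avoids the exponent 2k - 1, which is truncated for
   k = 0. *)
rewrite -(pmulr_rge0 _ t0) mulrDr mulrA.
have := ler_norm (- low); rewrite normrN => lown.
have : `|t| * - low <= `|t| * `|low| by rewrite ler_pM2l.
have : B * t ^+ (2 * k) <= `|t| * p`_(2 * k) * t ^+ (2 * k).
  by rewrite ler_wpM2r.
by lra.
Qed.

Lemma one_plus_X2_exp (A : nzRingType) (k : nat) :
  (1 + 'X^2 : {poly A}) ^+ k \is monic /\
  size ((1 + 'X^2 : {poly A}) ^+ k) = (2 * k).+1.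
Proof.
have m : (1 + 'X^2 : {poly A}) \is monic.
  by rewrite addrC -polyC1 monicXnaddC.
split; first exact: monic_exp.
elim: k => [|k IH]; first by rewrite expr0 size_poly1.
rewrite exprS size_Mmonic ?monic_neq0 ?monic_exp // IH.
by rewrite addrC -polyC1 size_XnaddC // mulnS !addSn.
Qed.

Lemma coef_one_plus_X2_exp (A : nzRingType) (k : nat) :
  ((1 + 'X^2 : {poly A}) ^+ k)`_(2 * k) = 1.
Proof.
have [/monicP m sz] := one_plus_X2_exp A k.
by move: m; rewrite /lead_coef sz.
Qed.

Lemma horner_one_plus_X2_exp (k : nat) (t : R) :
  ((1 + 'X^2) ^+ k).[t] = (1 + t ^+ 2) ^+ k.
Proof. by rewrite horner_exp !hornerE. Qed.

Lemma one_plus_sqr_gt0 (t : R) : 0 < 1 + t ^+ 2.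
Proof. by rewrite ltr_pwDl // sqr_ge0. Qed.

(** A negative coefficient of degree 2k would make p negative far away from the
    origin, and J has points there. *)
Lemma Pos_coef_ge0 J p (k : nat) : ~ bounded_set J ->
  (size p <= (2 * k).+1)%N -> Pos J p -> 0 <= p`_(2 * k).
Proof.
move=> Junb sp Jp; rewrite leNgt; apply/negP => p_lt0; apply: Junb.
(* The second term keeps half of the positive coefficient of - p in reserve,
   so that q >= 0 near infinity gives p < 0 there, and not only p <= 0. *)
pose q := - p + (p`_(2 * k) / 2)%:P * (1 + 'X^2) ^+ k.
have sq : (size q <= (2 * k).+1)%N.
  rewrite (leq_trans (size_polyD _ _)) // geq_max size_polyN sp /= mul_polyC.
  by rewrite (leq_trans (size_scale_leq _ _)) // (one_plus_X2_exp R k).2.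
have q_gt0 : 0 < q`_(2 * k).
  by rewrite coefD coefN coefCM coef_one_plus_X2_exp mulr1; lra.
have [T qT] := horner_even_degree_ge0 sq q_gt0.
exists T; split; first exact: num_real.
move=> M TM t Jt /=; apply: le_trans (ltW TM).
rewrite leNgt; apply/negP => /ltW /qT.
rewrite hornerD hornerN hornerCM horner_one_plus_X2_exp.
have := Jp _ Jt; have := exprn_gt0 k (one_plus_sqr_gt0 t); nra.
Qed.

(** Half of the top coefficient serves as eps outside some interval [-T, T]; on
    the compact set of the points of J in that interval, the quotient of p by
    (1 + t^2)^k attains a positive minimum. *)
Lemma Pos_sub_eps J p (k : nat) : closed J ->
    (size p <= (2 * k).+1)%N -> (forall t, J t -> 0 < p.[t]) ->
    0 < p`_(2 * k) ->
  exists eps : R, 0 < eps /\ Pos J (p - eps *: (1 + 'X^2) ^+ k).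
Proof.
move=> Jclosed sp Jp p_gt0.
pose c := p`_(2 * k) / 2; have c0 : 0 < c by rewrite divr_gt0.
have E0 (t : R) : 0 < (1 + t ^+ 2) ^+ k.
  by rewrite exprn_gt0 // one_plus_sqr_gt0.
pose q := p - c *: (1 + 'X^2) ^+ k.
have sq : (size q <= (2 * k).+1)%N.
  rewrite (leq_trans (size_polyD _ _)) // geq_max sp size_polyN /=.
  by rewrite (leq_trans (size_scale_leq _ _)) // (one_plus_X2_exp R k).2.
have q_gt0 : 0 < q`_(2 * k).
  by rewrite coefD coefN coefZ coef_one_plus_X2_exp mulr1 /c; lra.
have [T pT] := horner_even_degree_ge0 sq q_gt0.
have far (t : R) : T <= `|t| -> c * (1 + t ^+ 2) ^+ k <= p.[t].
  move=> /pT; rewrite hornerD hornerN hornerZ horner_one_plus_X2_exp.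
  by rewrite subr_ge0.
suff [m [m0 near]] : exists m : R, 0 < m /\
    forall t, J t -> `|t| <= T -> m * (1 + t ^+ 2) ^+ k <= p.[t].
  exists (Num.min m c); rewrite lt_min m0 c0; split=> // t Jt.
  rewrite hornerD hornerN hornerZ horner_one_plus_X2_exp subr_ge0.
  have [/far|/ltW/(near _ Jt)] := leP T `|t|; apply: le_trans.
    by rewrite ler_wpM2r ?(ltW (E0 t)) // ge_min lexx orbT.
  by rewrite ler_wpM2r ?(ltW (E0 t)) // ge_min lexx.
pose K := `[- T, T] `&` J.
have [K0|K0] := pselect (K !=set0); last first.
  exists 1; split=> // t Jt tT; exfalso; apply: K0; exists t; split=> //=.
  by rewrite in_itv /= -ler_norml.
have Kcompact : compact K.
  by apply: compact_closedI => //; exact: segment_compact.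
pose g (t : R) := p.[t] / (1 + t ^+ 2) ^+ k.
have gcont : continuous g.
  move=> t; apply: cvgM; first exact: continuous_horner.
  apply: cvgV; first by rewrite gt_eqF.
  have := @continuous_horner R ((1 + 'X^2) ^+ k) t.
  by rewrite (_ : horner _ = fun x => (1 + x ^+ 2) ^+ k) //;
    apply/funext => x; exact: horner_one_plus_X2_exp.
have [x Kx xmin] := compact_EVT_min K0 Kcompact (continuous_subspaceT gcont).
exists (g x); split=> [|t Jt tT].
  by rewrite divr_gt0 //; apply: Jp; move: Kx; rewrite inE => -[].
rewrite -ler_pdivlMr //; apply: xmin; rewrite inE; split=> //=.
by rewrite in_itv /= -ler_norml.
Qed.

(** The reason is that |t|^i is at most 1 when |t| <= 1 and at most
    (t^2)^k otherwise. *)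
Lemma Pos_X2_exp_addXn J (k i : nat) (b : bool) : (i <= 2 * k)%N ->
  Pos J ((1 + 'X^2) ^+ k + (-1) ^+ b *: 'X^i).
Proof.
move=> ik t _; rewrite hornerD hornerZ hornerXn horner_one_plus_X2_exp.
have ti : `|t| ^+ i <= (1 + t ^+ 2) ^+ k.
  have [t1|t1] := leP `|t| 1.
    apply: (@le_trans _ _ 1); first exact: exprn_ile1.
    by rewrite exprn_ege1 // lerDl sqr_ge0.
  apply: (@le_trans _ _ (`|t| ^+ (2 * k))); first by rewrite ler_weXn2l // ltW.
  by rewrite exprM real_normK ?num_real // lerXn2r ?nnegrE ?lerDr ?addr_ge0 ?sqr_ge0.
have : `|(-1) ^+ b * t ^+ i| <= (1 + t ^+ 2) ^+ k.
  by rewrite normrMsign normrX.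
by rewrite ler_norml => /andP[]; lra.
Qed.

End RealPolynomials.
(** * A Positivstellensatz for modules over an Archimedean semiring *)

Section ArchimedeanModules.
Context (R : realType) (A : comAlgType R) (S : set A) (W : lmodType A).
Hypotheses (hS : is_semiring S) (hSarch : is_archimedean S).

Definition S_cone (M : set W) : Prop :=
  (forall x y, M x -> M y -> M (x + y)) /\
  (forall s x, S s -> M x -> M (s *: x)).

Lemma semiring_scalar (r : R) : 0 <= r -> S r%:A.
Proof. by case: hS => S1 _ SZ _ r0; apply: SZ. Qed.

Lemma semiring0 : S 0.
Proof. by rewrite -(scale0r (1 : A)); apply: semiring_scalar. Qed.

Definition order_unit (M : set W) (e : W) : Prop :=
  M e /\ forall x, exists l : R, 0 <= l /\ M (l%:A *: e - x).

Lemma S_cone0 (M : set W) (e : W) : S_cone M -> M e -> M 0.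
Proof. by move=> [_ MZ] Me; rewrite -(scale0r e); exact: MZ semiring0 Me. Qed.

Lemma order_unit_sub (M M' : set W) (e : W) :
  M `<=` M' -> order_unit M e -> order_unit M' e.
Proof.
move=> sub [Me unit]; split=> [|x]; first exact: sub.
by have [l [l0 /sub Ml]] := unit x; exists l.
Qed.

(** If neither x nor its opposite is in M, maximality gives
    - e = m1 + s1 x and - e = m2 - s2 x.  Eliminating x between the two shows
    that - (s1 e) is in M.  As e is an order unit, l e + x is in M for some
    real l >= 0, so M contains s1 (l e + x) - l (s1 e) = s1 x, and then also
    m1 + s1 x = - e. *)
Lemma maximal_S_cone_total (M : set W) (e : W) :
    S_cone M -> order_unit M e -> ~ M (- e) ->
    (forall M', S_cone M' -> M `<=` M' -> ~ M' (- e) -> M' `<=` M) ->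
  forall x, M x \/ M (- x).
Proof.
move=> Mcone [Me unit] Mproper Mmax.
have [MD MZ] := Mcone; have M0 := S_cone0 Mcone Me; have [S1 SD _ SM] := hS.
have adjoin x : ~ M x ->
    exists m s, [/\ M m, S s & - e = m + s *: x].
  move=> Mx; apply: contrapT => none; apply: Mx.
  apply: (Mmax [set y | exists m s, [/\ M m, S s & y = m + s *: x]]).
  - split=> [y z [m [s [Mm Ss ->]]] [m' [s' [Mm' Ss' ->]]]|t y St].
      exists (m + m'), (s + s'); split; [exact: MD|exact: SD|].
      by rewrite scalerDl addrACA.
    move=> [m [s [Mm Ss ->]]]; exists (t *: m), (t * s).
    by split; [exact: MZ|exact: SM|rewrite scalerDr scalerA].
  - by move=> y My; exists y, 0; split; [|exact: semiring0|rewrite scale0r addr0].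
  - exact: none.
  - by exists 0, 1; split => //; rewrite scale1r add0r.
move=> x; apply: contrapT => /not_orP[/adjoin[m1 [s1 [Mm1 Ss1 e1]]]].
move=> /adjoin[m2 [s2 [Mm2 Ss2 e2]]]; apply: Mproper.
have Ms1e : M (- (s1 *: e)).
  have -> : - (s1 *: e) = s2 *: e + (s2 *: m1 + s1 *: m2).
    have -> : s2 *: m1 = - (s2 *: e) - (s1 * s2) *: x.
      have -> : m1 = - e - s1 *: x by rewrite e1 addrK.
      by rewrite scalerDr !scalerN scalerA mulrC.
    have -> : s1 *: m2 = - (s1 *: e) + (s1 * s2) *: x.
      have -> : m2 = - e + s2 *: x by rewrite e2 scalerN subrK.
      by rewrite scalerDr scalerN scalerA.
    by rewrite addrACA addNr addr0 addrA subrr add0r.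
  by apply: (MD); [exact: MZ|apply: (MD); exact: MZ].
have [l [l0 Ml]] := unit (- x); rewrite opprK in Ml.
rewrite e1; apply: (MD) => //.
have -> : s1 *: x = s1 *: (l%:A *: e + x) + l%:A *: (- (s1 *: e)).
  by rewrite scalerDr scalerN !scalerA mulrC addrAC subrr add0r.
apply: (MD); apply: (MZ) => //; exact: semiring_scalar.
Qed.

Lemma exists_maximal_S_cone (P : set W) (e : W) :
    S_cone P -> ~ P (- e) ->
  exists M, [/\ S_cone M, P `<=` M, ~ M (- e) &
    forall M', S_cone M' -> M `<=` M' -> ~ M' (- e) -> M' `<=` M].
Proof.
move=> Pcone Pproper; have [PD PZ] := Pcone.
(* The union with P makes the empty set good, as required by the empty chain,
   and provides a maximal cone that contains P. *)
pose good (X : set W) := S_cone (X `|` P) /\ ~ (X `|` P) (- e).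
have [F Fgood Ftot|M [[Mcone Mproper] Mmax]] := @Zorn_bigcup W good.
  have inU X y : F X -> (X `|` P) y -> ((\bigcup_(Z in F) Z) `|` P) y.
    by move=> FX [Xy|Py]; [left; exists X|right].
  split; last by move=> [[X FX Xe]|//]; case: (Fgood _ FX) => _; apply; left.
  split=> [x y|s x Ss].
    move=> [[X FX Xx]|Px] [[Y FY Yy]|Py]; last by right; exact: PD.
    - have [XY|YX] := Ftot _ _ FX FY.
        apply: (inU _ _ FY); apply: (Fgood _ FY).1.1; left => //; exact: XY.
      apply: (inU _ _ FX); apply: (Fgood _ FX).1.1; left => //; exact: YX.
    - by apply: (inU _ _ FX); apply: (Fgood _ FX).1.1; [left|right].
    - by apply: (inU _ _ FY); apply: (Fgood _ FY).1.1; [right|left].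
  move=> [[X FX Xx]|Px]; last by right; exact: PZ.
  by apply: (inU _ _ FX); apply: (Fgood _ FX).1.2 => //; left.
exists (M `|` P); split => // M' M'cone sub M'proper.
have PM' : M' `|` P = M' by apply/setUidPl => y Py; apply: sub; right.
move=> y M'y; left; apply: contrapT => My.
apply: (Mmax M'); last by rewrite /good PM'.
split; last by move=> M'M; apply: My; exact: M'M.
by move=> z Mz; apply: sub; left.
Qed.

(** The state is L x = sup {l | x - l e in M}.  Totality makes it additive,
    since x lies below l e in the order of M whenever l > L x.  For b in S,
    multiplying x - l e in M by b gives l * L (b e) <= L (b x) for all
    l < L x, hence L x * L (b e) <= L (b x); the same inequality for - x is
    the reverse one.  So b |-> L (b e) is multiplicative on S, and on A by
    adding a constant to b. *)
Lemma total_S_cone_state (M : set W) (e : W) :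
    S_cone M -> order_unit M e -> ~ M (- e) -> (forall x, M x \/ M (- x)) ->
  exists (L : W -> R) (phi : {lrmorphism A -> R | *%R}),
    [/\ forall x y, L (x + y) = L x + L y,
        forall b x, L (b *: x) = phi b * L x,
        L e = 1, forall x, M x -> 0 <= L x & char S phi].
Proof.
move=> Mcone [Me unit] Mproper Mtotal.
have [MD MZ] := Mcone; have M0 := S_cone0 Mcone Me; have [S1 SD _ SM] := hS.
have MR (r : R) x : 0 <= r -> M x -> M (r%:A *: x).
  by move=> r0; apply: MZ; exact: semiring_scalar.
have MRe_ge0 (r : R) : M (r%:A *: e) -> 0 <= r.
  move=> Mre; rewrite leNgt; apply/negP => r0; apply: Mproper.
  have : M ((- r^-1)%:A *: (r%:A *: e)).
    by apply: MR => //; rewrite oppr_ge0 invr_le0 ltW.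
  by rewrite scalerA -scalerAl mul1r scalerA mulNr mulVf ?lt_eqF// !scaleN1r.
pose below x := [set l : R | M (x - l%:A *: e)].
pose L x := sup (below x).
have below_nonempty x : below x !=set0.
  have [l [l0 Ml]] := unit (- x); exists (- l).
  by rewrite /below /= scaleNr scaleNr opprK addrC -{1}(opprK x).
have below_bounded x : has_ubound (below x).
  have [l [l0 Ml]] := unit x; exists l => m Mm.
  rewrite -subr_ge0; apply: MRe_ge0.
  by rewrite scalerBl scalerBl -(subrKA x) ; exact: MD.
have L_gt x l : l < L x -> M (x - l%:A *: e).
  move=> lL; have [m Mm lm] : exists2 m, below x m & l < m.
    have d0 : 0 < L x - l by rewrite subr_gt0.
    have [m Mm] := sup_adherent d0 (conj (below_nonempty x) (below_bounded x)).
    by rewrite subKr; exists m.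
  rewrite -(subrKA (m%:A *: e)) -scalerBl -scalerBl; apply: (MD) => //.
  by apply: MR => //; rewrite subr_ge0 ltW.
have L_ge x l : M (x - l%:A *: e) -> l <= L x.
  by move=> Ml; exact: (ub_le_sup (below_bounded x)).
have L_lt x l : L x < l -> M (l%:A *: e - x).
  move=> Ll; rewrite -opprB; case: (Mtotal (x - l%:A *: e)) => // /L_ge.
  by rewrite leNgt Ll.
have L_le x l : M (l%:A *: e - x) -> L x <= l.
  move=> Ml; rewrite leNgt; apply/negP => lL.
  have Mm : M (x - ((l + L x) / 2)%:A *: e) by apply: L_gt; lra.
  suff : 0 <= l - (l + L x) / 2 by lra.
  apply: MRe_ge0; rewrite scalerBl scalerBl -(subrKA x); exact: MD.
have LD x y : L (x + y) = L x + L y.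
  apply/le_anti/andP; split; apply/ler_addgt0Pr => d d0.
    have Mx : M ((L x + d / 2)%:A *: e - x) by apply: L_lt; lra.
    have My : M ((L y + d / 2)%:A *: e - y) by apply: L_lt; lra.
    apply: L_le; have := MD _ _ Mx My; congr M.
    rewrite addrACA -opprD -scalerDl -scalerDl; congr ((_ *: _) *: _ - _).
    by field.
  have Mx : M (x - (L x - d / 2)%:A *: e) by apply: L_gt; lra.
  have My : M (y - (L y - d / 2)%:A *: e) by apply: L_gt; lra.
  rewrite -lerBlDr; apply: L_ge; have := MD _ _ Mx My; congr M.
  rewrite addrACA -opprD -scalerDl -scalerDl; congr (_ - (_ *: _) *: _).
  by field.
have Le (r : R) : L (r%:A *: e) = r.
  by apply/le_anti; rewrite L_le ?L_ge // subrr.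
have L0 : L 0 = 0 by rewrite -(Le 0) !scale0r.
have LN x : L (- x) = - L x.
  by apply/eqP; rewrite -addr_eq0 -LD addNr L0.
have L_ge0 x : M x -> 0 <= L x.
  by move=> Mx; apply: L_ge; rewrite !scale0r subr0.
(* Both scaling laws below follow from a one-sided estimate, applied to a
   vector and to its opposite. *)
have scale_of_le (g : W -> R) (c : R) : 0 <= c ->
    (forall x, g (- x) = - g x) ->
    (forall x l, l < L x -> c * l <= g x) -> forall x, g x = c * L x.
  move=> c0 gN gle.
  have half x : c * L x <= g x.
    apply/ler_addgt0Pr => d d0; have c1 : 0 < c + 1 by lra.
    have : c * (L x - d / (c + 1)) <= g x.
      by apply: gle; rewrite ltrBlDr ltrDl divr_gt0.
    have : c * (d / (c + 1)) <= d.
      by rewrite mulrA ler_pdivrMr //; nra.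
    by rewrite mulrBr; lra.
  move=> x; apply/le_anti; rewrite half andbT.
  by rewrite -lerN2 -gN -mulrN -LN half.
have LR (r : R) x : L (r%:A *: x) = r * L x.
  have pos (c : R) y : 0 <= c -> L (c%:A *: y) = c * L y.
    move=> c0; apply: (scale_of_le (fun y => L (c%:A *: y))) => // {}y.
      by rewrite scalerN LN.
    move=> l /L_gt /(MR c _ c0) Ml; apply: L_ge; move: Ml.
    by rewrite scalerBr [_ *: (_ *: e)]scalerA -scalerAl mul1r scalerA.
  have [r0|r0] := leP 0 r; first exact: pos.
  have := pos (- r) x; rewrite oppr_ge0 ltW // => /(_ isT).
  by rewrite scaleNr scaleNr LN mulNr => /oppr_inj.
have LS b x : S b -> L (b *: x) = L (b *: e) * L x.
  move=> Sb; apply: (scale_of_le (fun y => L (b *: y))) => [|y|y l].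
  - by apply: L_ge0; exact: MZ.
  - by rewrite scalerN LN.
  - move=> /L_gt /(MZ _ _ Sb) /L_ge0.
    rewrite scalerBr scalerA mulrC -scalerA LD LN LR subr_ge0.
    by rewrite mulrC.
have LA b x : L (b *: x) = L (b *: e) * L x.
  have [l [l0 _ Slb]] := hSarch b.
  have := LS _ x Slb; rewrite scalerDl LD scalerDl LD Le LR mulrDl.
  exact: addrI.
pose phi0 b := L (b *: e).
have phi0_zmod : zmod_morphism phi0.
  by move=> b c; rewrite /phi0 scalerBl LD LN.
have phi0_mon : monoid_morphism phi0.
  split; first by rewrite /phi0 -(scale1r (1 : A)) Le.
  by move=> b c; rewrite /phi0 -scalerA LA.
have phi0_scal : scalable_for *%R phi0.
  by move=> r b; rewrite /phi0 -(mul1r b) scalerAl -scalerA LR mul1r.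
pose phi : {lrmorphism A -> R | *%R} := HB.pack phi0
  (GRing.isZmodMorphism.Build _ _ phi0 phi0_zmod)
  (GRing.isMonoidMorphism.Build _ _ phi0 phi0_mon)
  (GRing.isScalable.Build _ _ _ _ phi0 phi0_scal).
exists L, phi; split => //.
  by rewrite -(Le 1) !scale1r.
by move=> b Sb; apply: L_ge0; exact: MZ.
Qed.

(** Let N > 0 be such that N 1 - s is in S.  The identity
    (N - s)(a + r e) + (s a - e) + r s e = N (a + r e) - e
    shows that if a + r e is in P with r >= 0, then so is a + (r - 1/N) e.
    Starting from an r given by the order unit, finitely many such steps make
    r negative. *)
Lemma archimedean_descent (P : set W) (e a : W) (s : A) :
    S_cone P -> order_unit P e -> S s -> P (s *: a - e) ->
  exists eps : R, 0 < eps /\ P (a - eps%:A *: e).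
Proof.
move=> Pcone [Pe unit] Ss Psa; have [PD PZ] := Pcone.
have [N [N0 SN _]] := hSarch s.
have step (r : R) : 0 <= r -> P (a + r%:A *: e) ->
    P (a + (r - N^-1)%:A *: e).
  move=> r0 Pr.
  have : P ((N^-1)%:A *: ((N%:A - s) *: (a + r%:A *: e) + (s *: a - e)
                          + s *: (r%:A *: e))).
    apply: (PZ); first by apply: semiring_scalar; rewrite invr_ge0 ltW.
    apply: (PD); first by apply: (PD) => //; exact: PZ.
    by apply: (PZ) => //; apply: PZ => //; exact: semiring_scalar.
  congr P.
  have -> : (N%:A - s) *: (a + r%:A *: e) + (s *: a - e) + s *: (r%:A *: e)
     = N%:A *: (a + r%:A *: e) - e.
    rewrite scalerBl -!addrA; congr (_ + _).
    by rewrite [in - (s *: _)]scalerDr opprD addrACA addNr add0r addrCA addNr addr0.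
  rewrite scalerBr scalerA -scalerAl mul1r scalerA mulVf ?gt_eqF //.
  by rewrite scale1r scale1r -addrA -scalerBl -scalerBl.
have [r0 [r0_ge0 Pr0]] := unit (- a).
have Psteps n : P (a + (r0 - n%:R / N)%:A *: e) \/
    exists eps : R, 0 < eps /\ P (a - eps%:A *: e).
  elim: n => [|n [IH|]]; last by right.
    by left; rewrite mul0r subr0 addrC -{1}(opprK a).
  have [r_ge0|r_lt0] := leP 0 (r0 - n%:R / N).
    left; have := step _ r_ge0 IH; congr (P (_ + (_ *: _) *: _)).
    by rewrite -addn1 natrD mulrDl mul1r; ring.
  right; exists (- (r0 - n%:R / N)); rewrite oppr_gt0; split => //.
  by rewrite scaleNr scaleNr opprK.
have [n rn] : exists n : nat, r0 * N < n%:R.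
  by exists (Num.bound (r0 * N)); rewrite archi_boundP // mulr_ge0 // ltW.
have [Pn|//] := Psteps n.
exists (n%:R / N - r0); rewrite subr_gt0 ltr_pdivlMr //; split=> //.
by move: Pn; rewrite -[in X in P X -> _]opprB scaleNr scaleNr.
Qed.

(** Apart from the case handled by the descent, - e is not in the S-cone Q
    generated by P and - a, so a maximal S-cone containing Q provides a state
    with L a <= 0. *)
Lemma archimedean_representation (P : set W) (e a : W) :
    S_cone P -> order_unit P e ->
    (forall (L : W -> R) (phi : {lrmorphism A -> R | *%R}),
      (forall x y, L (x + y) = L x + L y) ->
      (forall b x, L (b *: x) = phi b * L x) ->
      L e = 1 -> (forall x, P x -> 0 <= L x) -> char S phi -> 0 < L a) ->
  exists eps : R, 0 < eps /\ P (a - eps%:A *: e).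
Proof.
move=> Pcone Punit pos; have [[PD PZ] [Pe _]] := (Pcone, Punit).
have [S1 SD _ SM] := hS; have P0 := S_cone0 Pcone Pe.
pose Q : set W := [set x | exists p s, [/\ P p, S s & x = p - s *: a]].
have [[p [s [Pp Ss eq]]]|Qproper] := EM (Q (- e)).
  apply: (archimedean_descent Pcone Punit Ss).
  by have -> : s *: a - e = p by rewrite eq addrC subrK.
have PQ : P `<=` Q.
  by move=> p Pp; exists p, 0; rewrite scale0r subr0; split=> //; exact: semiring0.
have Qcone : S_cone Q.
  split=> [x y [p [s [Pp Ss ->]]] [p' [s' [Pp' Ss' ->]]]|t y St].
    exists (p + p'), (s + s'); split; [exact: PD|exact: SD|].
    by rewrite scalerDl addrACA opprD.
  move=> [p [s [Pp Ss ->]]]; exists (t *: p), (t * s).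
  by split; [exact: PZ|exact: SM|rewrite scalerBr scalerA].
have [M [Mcone QM Mproper Mmax]] := exists_maximal_S_cone Qcone Qproper.
have Munit := order_unit_sub (subset_trans PQ QM) Punit.
have Mtotal := maximal_S_cone_total Mcone Munit Mproper Mmax.
have [L [phi [LD LZ Le Lpos phiS]]] :=
  total_S_cone_state Mcone Munit Mproper Mtotal.
have La : 0 < L a.
  by apply: (pos L phi) => // x Px; apply: Lpos; apply: QM; exact: PQ.
have : 0 <= L (- a).
  by apply: Lpos; apply: QM; exists 0, 1; rewrite scale1r sub0r.
by rewrite -scaleN1r LZ rmorphN1; lra.
Qed.

End ArchimedeanModules.

(** * The cone generated by S and Pos(J) in A[z] *)

Section TensorCone.
Context (R : realType) (A : comAlgType R) (S : set A) (J : set R).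

Local Notation emb := (map_poly (in_alg A)).

Lemma tensor_PosD (q q' : {poly A}) :
  tensor_Pos S J q -> tensor_Pos S J q' -> tensor_Pos S J (q + q').
Proof.
move=> [n [b [p [Sb Jp ->]]]] [n' [b' [p' [Sb' Jp' ->]]]].
exists (n + n')%N,
  (fun i => match fintype.split i with inl j => b j | inr j => b' j end),
  (fun i => match fintype.split i with inl j => p j | inr j => p' j end).
split=> [i|i|]; [by case: fintype.split|by case: fintype.split|].
rewrite big_split_ord /=; congr (_ + _); apply: eq_bigr => i _.
  by rewrite (unsplitK (inl i)).
by rewrite (unsplitK (inr i)).
Qed.

Lemma tensor_PosZ (s : A) (q : {poly A}) : is_semiring S -> S s ->
  tensor_Pos S J q -> tensor_Pos S J (s *: q).
Proof.
move=> [_ _ _ SM] Ss [n [b [p [Sb Jp ->]]]].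
exists n, (fun i => s * b i), p; split=> // [i|]; first exact: SM.
by rewrite scaler_sumr; apply: eq_bigr => i _; rewrite scalerA.
Qed.

Lemma tensor_Pos_pure (b : A) (p : {poly R}) :
  S b -> Pos J p -> tensor_Pos S J (b *: emb p).
Proof.
move=> Sb Jp; exists 1%N, (fun=> b), (fun=> p); split=> //.
by rewrite big_ord1.
Qed.

Lemma map_poly_char_in_alg (phi : {lrmorphism A -> R | *%R}) (p : {poly R}) :
  map_poly phi (emb p) = p.
Proof.
by apply/polyP => i; rewrite !coef_map /= linearZ /= rmorph1 mulr1.
Qed.

Lemma in_alg_one_plus_X2_exp (k : nat) :
  emb ((1 + 'X^2) ^+ k) = (1 + 'X^2) ^+ k.
Proof. by rewrite rmorphXn rmorphD /= map_polyXn rmorph1. Qed.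

Lemma tensor_Pos_char (phi : {lrmorphism A -> R | *%R}) (q : {poly A}) :
  char S phi -> tensor_Pos S J q -> Pos J (map_poly phi q).
Proof.
move=> Sphi [n [b [p [Sb Jp ->]]]] t Jt.
rewrite rmorph_sum horner_sum; apply: sumr_ge0 => i _.
rewrite -mul_polyC rmorphM /= map_polyC map_poly_char_in_alg hornerCM.
by rewrite mulr_ge0 ?Jp //; exact: Sphi.
Qed.

Lemma char_evalr (phi : {lrmorphism A -> R | *%R}) (a : {poly A}) (eta : R) :
  phi (evalr a eta) = (map_poly phi a).[eta].
Proof.
have -> : eta = phi eta%:A by rewrite linearZ /= rmorph1 mulr1.
by rewrite horner_map /= /evalr linearZ /= rmorph1 mulr1.
Qed.

(** It suffices to dominate each monomial x_m z^m.  If mu 1 - x_m and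
    mu 1 + x_m are in S, then
    (mu - x_m)(E + z^m) + (mu + x_m)(E - z^m) = 2 (mu E - x_m z^m),
    with E = (1 + z^2)^k. *)
Lemma tensor_Pos_order_unit (k : nat) (x : {poly A}) :
    is_semiring S -> is_archimedean S -> (size x <= (2 * k).+1)%N ->
  exists l : R, 0 <= l /\ tensor_Pos S J (l%:A *: (1 + 'X^2) ^+ k - x).
Proof.
move=> hS hSarch sx; rewrite -[x](coefK x) poly_def.
rewrite -(big_mkord xpredT (fun i => x`_i *: 'X^i)).
have : (size x <= (2 * k).+1)%N by [].
elim: (size x) => [_|m IH m_le].
  exists 0; rewrite big_geq // subr0 !scale0r; split => //.
  by exists 0%N, (fun=> 0), (fun=> 0); split; [case|case|rewrite big_ord0].
have [l [l0 Pl]] := IH (ltnW m_le).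
have [mu [mu0 Sminus Splus]] := hSarch x`_m.
exists (l + mu); split; first by rewrite addr_ge0 // ltW.
rewrite big_nat_recr //= scalerDl scalerDl opprD addrACA.
apply: tensor_PosD => //.
have half : S (2^-1)%:A by apply: (semiring_scalar hS); rewrite invr_ge0.
have Pm := fun b => @Pos_X2_exp_addXn R J k m b m_le.
have := tensor_PosZ hS half (tensor_PosD
  (tensor_Pos_pure Sminus (Pm false)) (tensor_Pos_pure Splus (Pm true))).
congr (tensor_Pos S J).
rewrite /= expr0 expr1 scale1r scaleN1r rmorphD rmorphB /= map_polyXn.
rewrite in_alg_one_plus_X2_exp.
set E := (1 + 'X^2) ^+ k; set z := 'X^m.
have -> : (mu%:A - x`_m) *: (E + z) + (mu%:A + x`_m) *: (E - z) =
          2%:A *: (mu%:A *: E - x`_m *: z).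
  rewrite scaler_nat -!mul_polyC polyCB polyCD polyC_natr.
  ring.
by rewrite scalerA -scalerAl mul1r scalerA mulVf ?pnatr_eq0 // !scale1r.
Qed.

End TensorCone.

(** * Polynomials of bounded degree and the equivalence *)

Lemma npoly_sum_X (A : nzRingType) (n : nat) (w : {poly_n A}) :
  w = \sum_(i < n) (val w)`_i *: npolyp n 'X^i.
Proof.
apply/npolyP => j; rewrite coefn_sum.
have [jn|jn] := ltnP j n; last first.
  by rewrite big_coef_npoly // big1 // => i _; rewrite big_coef_npoly.
rewrite (bigD1 (Ordinal jn)) //= coefZ coef_npolyp jn coefXn eqxx mulr1.
rewrite big1 ?addr0 // => i; rewrite -val_eqE /= => ij.
by rewrite coefZ coef_npolyp jn coefXn eq_sym (negPf ij) mulr0.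
Qed.

(** Expanding w in powers of z gives L w as the sum of the products
    phi(w_i) * L (z^i). *)
Lemma eq_state_of_map_poly (R : realType) (A : comAlgType R) (n : nat)
    (L : {poly_n A} -> R) (phi : {lrmorphism A -> R | *%R}) :
    (forall x y, L (x + y) = L x + L y) ->
    (forall b x, L (b *: x) = phi b * L x) ->
  forall w w', map_poly phi (val w) = map_poly phi (val w') -> L w = L w'.
Proof.
move=> LD LZ w w' eq_w.
have L0 : L 0 = 0 by rewrite -(scale0r 0) LZ rmorph0 mul0r.
rewrite [w]npoly_sum_X [w']npoly_sum_X !(big_morph L LD L0).
apply: eq_bigr => i _; rewrite !LZ; congr (_ * _).
by have := congr1 (fun p : {poly R} => p`_i) eq_w; rewrite !coef_map.
Qed.

Theorem theorem11p1 (R : realType) (A : comAlgType R)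
    (hA : finitely_generated A)
    (S : set A) (hS : is_semiring S) (hSarch : is_archimedean S)
    (J : set R) (hJclosed : closed J) (hJunbounded : ~ bounded_set J)
    (k : nat) (a : {poly A}) (ha : (size a <= (2 * k).+1)%N) :
  ((forall (phi : {lrmorphism A -> R | *%R}) (eta : R),
      char S phi -> J eta -> 0 < phi (evalr a eta)) /\
   (forall psi : {lrmorphism A -> R | *%R},
      char S psi -> 0 < psi a`_(2 * k)))
  <->
  (exists eps : R, 0 < eps /\
     exists q : {poly A}, tensor_Pos S J q /\
       a = eps%:A *: (1 + 'X^2) ^+ k + q).
Proof.
have size_map phi : (size (map_poly phi a : {poly R}) <= (2 * k).+1)%N.
  exact: leq_trans (size_poly _ _) ha.
have map_E (phi : {lrmorphism A -> R | *%R}) (c : R) :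
    map_poly phi (c%:A *: (1 + 'X^2) ^+ k) = c *: (1 + 'X^2) ^+ k.
  rewrite -in_alg_one_plus_X2_exp -mul_polyC rmorphM /= map_polyC.
  by rewrite map_poly_char_in_alg /= linearZ /= rmorph1 mulr1 mul_polyC.
split=> [[pos_eval pos_top]|[eps [eps0 [q [Pq aE]]]]]; last first.
  have phi_a (phi : {lrmorphism A -> R | *%R}) :
      map_poly phi a = eps *: (1 + 'X^2) ^+ k + map_poly phi q.
    by rewrite {1}aE rmorphD /= map_E.
  have size_q (phi : {lrmorphism A -> R | *%R}) :
      (size (map_poly phi q) <= (2 * k).+1)%N.
    have -> : map_poly phi q = map_poly phi a - eps *: (1 + 'X^2) ^+ k.
      by rewrite phi_a addrC addKr.
    rewrite (leq_trans (size_polyD _ _)) // geq_max size_map size_polyN /=.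
    by rewrite (leq_trans (size_scale_leq _ _)) // (one_plus_X2_exp R k).2.
  split=> [phi eta Sphi Jeta|psi Spsi].
    rewrite char_evalr phi_a hornerD hornerZ horner_one_plus_X2_exp.
    have := tensor_Pos_char Sphi Pq Jeta; apply: ltr_pwDl.
    by rewrite mulr_gt0 // exprn_gt0 // one_plus_sqr_gt0.
  rewrite -coef_map /= phi_a coefD coefZ coef_one_plus_X2_exp mulr1.
  apply: ltr_pwDl => //.
  exact: Pos_coef_ge0 hJunbounded (size_q _) (tensor_Pos_char Spsi Pq).
pose W := {poly_((2 * k).+1) A}.
pose P : set W := [set w | tensor_Pos S J (val w)].
have sE : (size ((1 + 'X^2 : {poly A}) ^+ k) <= (2 * k).+1)%N.
  by rewrite (one_plus_X2_exp A k).2.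
pose e : W := NPoly sE.
pose w : W := NPoly ha.
have Pcone : S_cone S P.
  by split=> [x y|s x Ss]; [exact: tensor_PosD|exact: tensor_PosZ].
have Punit : order_unit P e.
  split=> [|x]; last exact: tensor_Pos_order_unit (size_npoly x).
  rewrite /P /= -in_alg_one_plus_X2_exp -[map_poly _ _]scale1r.
  apply: tensor_Pos_pure; first by case: hS.
  move=> t _; rewrite horner_one_plus_X2_exp exprn_ge0 //.
  exact: ltW (one_plus_sqr_gt0 t).
have [L phi LD LZ Le Lpos Sphi|eps [eps0 Peps]] :=
    archimedean_representation hS hSarch (a := w) Pcone Punit.
  have [t Jt||c [c0 Jc]] := @Pos_sub_eps R J (map_poly phi a) k hJclosed
    (size_map phi).
  - by rewrite -char_evalr; exact: pos_eval.
  - by rewrite coef_map; exact: pos_top.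
  set p := map_poly phi a - _ in Jc.
  have sp : (size (map_poly (in_alg A) p) <= (2 * k).+1)%N.
    rewrite (leq_trans (size_poly _ _)) // (leq_trans (size_polyD _ _)) //.
    rewrite geq_max size_map size_polyN /=.
    by rewrite (leq_trans (size_scale_leq _ _)) // (one_plus_X2_exp R k).2.
  pose y : W := NPoly sp.
  have Ly : 0 <= L y.
    apply: Lpos; rewrite /P /= -[map_poly _ _]scale1r.
    by apply: tensor_Pos_pure => //; case: hS.
  have eq_y : L (w - c%:A *: e) = L y.
    apply: (eq_state_of_map_poly LD LZ).
    by rewrite /= map_poly_char_in_alg rmorphB /= map_E.
  move: Ly; rewrite -eq_y LD -scaleNr LZ Le mulr1 rmorphN /=.
  by rewrite linearZ /= rmorph1 mulr1 subr_ge0; exact: lt_le_trans.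
exists eps; split => //; exists (a - eps%:A *: (1 + 'X^2) ^+ k).
split; first exact: Peps.
by rewrite addrC subrK.
Qed.
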